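(* Suppose the random Hermitian coupling operator $A_a$ satisfies $\mathbb E\big[(A_a)_{i,j}\overline{(A_a)_{l,k}}\big]=\xi^2\delta_{i,l}\delta_{j,k}$ for all $i,j,k,l\in\{1,\dots,N\}$, where $\xi>0$ and $c_1N^{-1/2}\le\xi\le c_2N^{-1/2}$ for constants $c_1,c_2>0$. Let $\beta>0$, let $\gamma(\omega)=\min(1,e^{-\beta\omega})$, and let $$r_\beta(H)=\frac{\#\{i\in\{1,\dots,N\}:\ \lambda_i\le\lambda_{\min}(H)+1/\beta\}}{N}.$$ Then there is a constant $c>0$, depending only on $c_1,c_2$, such that the spectral gap $\eta$ of the Lindblad generator $\bar{\mathcal L}=\mathbb E_a[\mathcal L_{K_a}]$ (with respect to $\sigma=e^{-\beta H}/\operatorname{Tr}(e^{-\beta H})$) satisfies $$\eta\ge c\,r_\beta(H),$$ i.e. $\eta=\Omega(r_\beta(H))$.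
   Context: $\mathcal H$ is a Hilbert space of dimension $N=2^n$ and $\mathcal B(\mathcal H)$ the space of operators on it. $H\in\mathcal B(\mathcal H)$ is a Hermitian Hamiltonian with eigenvalues $\lambda_1,\dots,\lambda_N$ (with multiplicity), smallest eigenvalue $\lambda_{\min}(H)$, and a corresponding orthonormal eigenbasis $|\psi_1\rangle,\dots,|\psi_N\rangle$; $B_H=\operatorname{spec}(H)-\operatorname{spec}(H)$. $\{A_a\}$ is an ensemble of random Hermitian operators in $\mathcal B(\mathcal H)$, $\mathbb E=\mathbb E_a$ is expectation over the ensemble, and $(A_a)_{i,j}=\langle\psi_i|A_a|\psi_j\rangle$. $f$ is an (integrable) weight function whose Fourier transform $\hat f(\omega)=\int_{-\infty}^\infty f(s)e^{i\omega s}\,ds$ satisfies $\hat f(\omega)=\sqrt{\gamma(\omega)}$ for all $\omega\in B_H$, and $$K_a=\int_{-\infty}^\infty f(s)e^{iHs}A_ae^{-iHs}\,ds=\sum_{i,j=1}^N\hat f(\lambda_i-\lambda_j)|\psi_i\rangle\langle\psi_i|A_a|\psi_j\rangle\langle\psi_j|,$$ $\mathcal L_{K_a}(\rho)=K_a\rho K_a^\dagger-\tfrac12\{K_a^\dagger K_a,\rho\}$. With $\langle X,Y\rangle_{\sigma,1/2}=\operatorname{Tr}(X^\dagger\sigma^{1/2}Y\sigma^{1/2})$, $\mathrm{Var}_\sigma(X)=\|X-\operatorname{Tr}(\sigma X)I\|_{\sigma,1/2}^2$, and $\bar{\mathcal L}^\dagger$ the Hilbert–Schmidt adjoint of $\bar{\mathcal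 L}$, the spectral gap is $$\eta=\inf_{X}\ \frac{-\langle X,\bar{\mathcal L}^\dagger X\rangle_{\sigma,1/2}}{\mathrm{Var}_\sigma(X)},$$ the infimum over $X\in\mathcal B(\mathcal H)$ that are not scalar multiples of the identity; equivalently, since $\bar{\mathcal L}^\dagger$ is self-adjoint for the KMS inner product, the smallest nonzero eigenvalue of $-\bar{\mathcal L}$. *)

(* Defs.v *)
From HB Require Import structures.
From mathcomp Require Import all_boot all_order all_algebra.
From mathcomp Require Import complex.
From mathcomp Require Import all_classical all_reals all_analysis.

Set Implicit Arguments.
Unset Strict Implicit.
Unset Printing Implicit Defensive.

Import Order.TTheory GRing.Theory Num.Theory.
Import numFieldNormedType.Exports.

#[global] Open Scope classical_set_scope.
#[global] Open Scope ring_scope.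
#[global] Open Scope complex_scope.
#[global] Open Scope sesquilinear_scope.

(* The Hilbert space of dimension N is the space of column vectors over R[i],
   with its standard inner product; operators are square matrices, and M^t* is
   the Hermitian adjoint of M. *)

Section HilbertSpace.
Context {R : realType} {N : nat}.
Local Notation C := R[i].
Implicit Types (A X Y : 'M[C]_N) (u v : 'cV[C]_N).

Definition braket u v : C := (u^t* *m v) 0 0.

Definition matrix_element u A v : C := (u^t* *m A *m v) 0 0.

Definition orthonormal_family (psi : 'I_N -> 'cV[C]_N) : Prop :=
  forall i j, braket (psi i) (psi j) = (i == j)%:R.

(* All the eigenvalues of a Hermitian A are real. *)
Definition spec A : set R := [set x | eigenvalue A x%:C].

Definition lambda_min A : R := inf (spec A).

Definition bohr_freq A : set R :=
  [set w | exists x y, [/\ spec A x, spec A y & w = x - y]].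

(* The operator g(A) for A Hermitian: the spectral theorem of the library gives
   A = P^-1 D P with P unitary and D diagonal (real). It does not depend on the
   diagonalization, see funcalc_eigen. *)
Definition funcalc (g : R -> C) A : 'M[C]_N :=
  let P := spectralmx A in
  invmx P *m diag_mx (map_mx (fun z : C => g (complex.Re z)) (spectral_diag A))
    *m P.

Lemma funcalc_eigen (g : R -> C) A v (x : R) :
  A \is hermsymmx -> A *m v = x%:C *: v -> funcalc g A *m v = g x *: v.
Proof.
move=> hA Av; rewrite /funcalc; set P := spectralmx A; set d := spectral_diag A.
have uP : P \in unitmx by exact: spectral_unit.
have dr k : d 0 k = (complex.Re (d 0 k))%:C.
  have /mxOverP/(_ 0 k) := hermitian_spectral_diag_real hA.
  case: (d 0 k) => a b; rewrite realE !lecE /=.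
  by move=> /orP[] /andP[/eqP b0 _]; [rewrite b0 | rewrite -b0].
have PA : P *m A = diag_mx d *m P.
  by rewrite [in LHS](orthomx_spectralP (hermitian_normalmx hA)) -/P -/d -mulmxA
     mulKVmx.
suff H : diag_mx (map_mx (fun z : C => g (complex.Re z)) d) *m (P *m v)
         = g x *: (P *m v).
  by rewrite -!mulmxA H -scalemxAr mulKmx.
have : diag_mx d *m (P *m v) = x%:C *: (P *m v).
  by rewrite mulmxA -PA -mulmxA Av scalemxAr.
move/matrixP => E; apply/matrixP => k j; have := E k j.
rewrite !mul_diag_mx !mxE.
move: (\sum_j0 _) => w; have [->|w0] := eqVneq w 0; first by rewrite !mulr0.
by move=> /(mulIf w0) ->.
Qed.

Definition cexpi (t : R) : C := cos t +i* sin t.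

(* e^{iHt} *)
Definition evolution (H : 'M[C]_N) (t : R) : 'M[C]_N :=
  funcalc (fun x => cexpi (x * t)) H.

Definition hs_inner X Y : C := \tr (X^t* *m Y).

(* The adjoint of a linear map L for hs_inner: its matrix elements in the
   orthonormal basis of matrix units are those of the conjugate transpose. *)
Definition hs_adjoint (L : 'M[C]_N -> 'M[C]_N) : 'M[C]_N -> 'M[C]_N :=
  fun X => \matrix_(i, j) (hs_inner X (L (delta_mx i j)))^*%R.

Lemma hs_innerE X Y : hs_inner X Y = \sum_i \sum_j (X i j)^*%R * Y i j.
Proof.
rewrite /hs_inner /mxtrace exchange_big /=; apply: eq_bigr => j _.
by rewrite mxE; apply: eq_bigr => i _; rewrite !mxE.
Qed.

Lemma hs_adjointP (L : {linear 'M[C]_N -> 'M[C]_N}) X Y :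
  hs_inner (hs_adjoint L X) Y = hs_inner X (L Y).
Proof.
rewrite {2}(matrix_sum_delta Y) linear_sum /hs_inner mulmx_sumr linear_sum /=.
rewrite -/(hs_inner _ _) hs_innerE; apply: eq_bigr => i _.
rewrite linear_sum mulmx_sumr linear_sum /=; apply: eq_bigr => j _.
by rewrite linearZ -scalemxAr linearZ /= mxE conjCK mulrC.
Qed.

Definition kms_inner (sigma X Y : 'M[C]_N) : C :=
  let S := funcalc (fun x => (Num.sqrt x)%:C) sigma in
  \tr (X^t* *m S *m Y *m S).

Definition variance_kms (sigma X : 'M[C]_N) : C :=
  let Y := X - (\tr (sigma *m X))%:M in kms_inner sigma Y Y.

(* The Rayleigh quotient is a real number when the adjoint of L is self-adjoint
   for kms_inner. The infimum is taken in the extended reals: in dimension 1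
   there is no non-scalar operator and the gap is +oo. *)
Definition spectral_gap (sigma : 'M[C]_N) (L : 'M[C]_N -> 'M[C]_N) : \bar R :=
  ereal_inf [set (complex.Re (- kms_inner sigma X (hs_adjoint L X)
                               / variance_kms sigma X))%:E
            | X in [set X | ~~ is_scalar_mx X]].

Definition gibbs (beta : R) (H : 'M[C]_N) : 'M[C]_N :=
  let E := funcalc (fun x => (expR (- (beta * x)))%:C) H in
  (\tr E)^-1 *: E.

Definition lindblad (K rho : 'M[C]_N) : 'M[C]_N :=
  K *m rho *m K^t* - 2^-1 *: (K^t* *m K *m rho + rho *m (K^t* *m K)).

End HilbertSpace.

Section Integrals.
Context {R : realType}.
Local Notation C := R[i].

(* The value is meaningful only when g is integrable. *)
Definition cintegral {d : measure_display} {T : measurableType d}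
    (mu : {measure set T -> \bar R}) (g : T -> C) : C :=
  (\int[mu]_(x in setT) complex.Re (g x)) +i*
  (\int[mu]_(x in setT) complex.Im (g x)).

(* Bochner integral of a matrix-valued function, computed entrywise. *)
Definition mxintegral {d : measure_display} {T : measurableType d} {N : nat}
    (mu : {measure set T -> \bar R}) (G : T -> 'M[C]_N) : 'M[C]_N :=
  \matrix_(i, j) cintegral mu (fun x => G x i j).

Definition cintegrable {d : measure_display} {T : measurableType d}
    (mu : {measure set T -> \bar R}) (g : T -> C) : Prop :=
  mu.-integrable setT (EFin \o (fun x => complex.Re (g x))) /\
  mu.-integrable setT (EFin \o (fun x => complex.Im (g x))).

Definition mxmeasurable {d : measure_display} {T : measurableType d} {N : nat}
    (G : T -> 'M[C]_N) : Prop :=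
  forall i j, measurable_fun setT (fun x => complex.Re (G x i j)) /\
              measurable_fun setT (fun x => complex.Im (G x i j)).

Definition fourier (f : R -> C) (w : R) : C :=
  cintegral lebesgue_measure (fun s => f s * cexpi (w * s)).

Definition metropolis (beta w : R) : R := Num.min 1 (expR (- (beta * w))).

Definition filtered {N : nat} (f : R -> C) (H A : 'M[C]_N) : 'M[C]_N :=
  mxintegral lebesgue_measure
    (fun s => f s *: (evolution H s *m A *m evolution H (- s))).

(* rho |-> E_a[L_{K_a}(rho)], for the ensemble A over the probability P *)
Definition mean_lindblad {d : measure_display} {T : measurableType d} {N : nat}
    (P : probability T R) (f : R -> C) (H : 'M[C]_N) (A : T -> 'M[C]_N)
    (rho : 'M[C]_N) : 'M[C]_N :=
  mxintegral P (fun a => lindblad (filtered f H (A a)) rho).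

Definition low_energy_ratio {N : nat} (beta : R) (H : 'M[C]_N)
    (lambda : 'I_N -> R) : R :=
  #|[set i | lambda i <= lambda_min H + beta^-1]%SET|%:R / N%:R.

End Integrals.

(* Main.v *)
(* In the eigenbasis of H the entries of K_a are pairwise uncorrelated, so the
   averaged generator decouples: on the diagonal it is the classical Metropolis
   chain with rates xi^2 gamma(lambda_i - lambda_j), and each off-diagonal entry
   (i, j) just decays, at rate xi^2 (D_i + D_j) / 2 with
   D_j = sum_i gamma(lambda_i - lambda_j).  A jump from any level into one of the
   r N low-energy levels k has gamma >= 1/e.  Hence D_j >= r N / e, which bounds
   the off-diagonal rates.  For the chain, detailed balance makes the edge weight
   gamma(lambda_k - lambda_i) p_i >= p_i / e, and averaging
   Var_p(x) <= sum_i p_i |x_i - x_k|^2 over the low-energy k bounds the variance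
   by the Dirichlet form.  Both rates are at least of order
   xi^2 r N >= c1^2 r. *)

Require Import Defs.
From HB Require Import structures.
From mathcomp Require Import all_boot all_order all_algebra.
From mathcomp Require Import complex.
From mathcomp Require Import all_classical all_reals all_analysis.
From mathcomp Require Import measurable_realfun ring.

Set Implicit Arguments.
Unset Strict Implicit.
Unset Printing Implicit Defensive.

Import Order.TTheory GRing.Theory Num.Theory.
Import numFieldNormedType.Exports.

(** * Variance and Dirichlet-form inequalities for a reversible chain *)

Section Poincare.
Context {C : numClosedFieldType} {I : finType}.
Implicit Types (p s x D : I -> C) (g : I -> I -> C).

(** Bias-variance decomposition: the second moment about [z] exceeds the one about the mean [mu] by
    exactly [|mu - z|^2]. *)
Lemma weighted_variance_le p x (mu z : C) :
  mu = \sum_i p i * x i -> \sum_i p i = 1 -> (forall i, 0 <= p i) ->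
  \sum_i p i * `|x i - mu| ^+ 2 <= \sum_i p i * `|x i - z| ^+ 2.
Proof.
move=> muE p1 p0.
have muJ : mu^*%R = \sum_i p i * (x i)^*%R.
  rewrite muE rmorph_sum /=; apply: eq_bigr => i _.
  by rewrite rmorphM /= (CrealP (ger0_real (p0 i))).
have -> : \sum_i p i * `|x i - z| ^+ 2
        = \sum_i p i * `|x i - mu| ^+ 2 + `|mu - z| ^+ 2.
  apply/eqP; rewrite -subr_eq0 opprD addrA -sumrB subr_eq0; apply/eqP.
  (* The difference of the two squares is affine in [x i] and its conjugate, so averaging against
     [p] replaces [x i] by [mu]. *)
  transitivity (mu * (mu - z)^*%R + (mu - z) * mu^*%R
                + \sum_i p i * (z * z^*%R - mu * mu^*%R)).
    rewrite [X in _ = _ + _ * X + _]muJ mulr_sumr.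
    rewrite [X in _ = X * _ + _ + _]muE mulr_suml -!big_split /=.
    apply: eq_bigr => i _.
    by rewrite !normCK !rmorphB /=; ring.
  by rewrite -mulr_suml p1 normCK rmorphB /=; ring.
by rewrite lerDl exprn_ge0.
Qed.

(** Detailed balance turns the right-hand side into half the sum of [g k i * p i * |x i - x k|^2].
    Keeping only the targets [k] in [L], where the rate is at least [e], each inner sum is at least
    [e] times a second moment about [x k], hence at least [e] times the variance. *)
Lemma dirichlet_form_ge g p x (mu e : C) (L : {set I}) :
  mu = \sum_i p i * x i -> \sum_i p i = 1 ->
  (forall i, 0 <= p i) -> (forall i k, 0 <= g i k) -> 0 <= e ->
  (forall i k, g i k * p k = g k i * p i) ->
  (forall i k, k \in L -> e <= g k i) ->
  e / 2 * #|L|%:R * \sum_i p i * `|x i - mu| ^+ 2 <=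
  \sum_i (\sum_k g k i) * p i * `|x i| ^+ 2
    - \sum_i (x i)^*%R * \sum_k g i k * (p k * x k).
Proof.
move=> muE p1 p0 g0 e0 gC gL.
have -> : \sum_i (\sum_k g k i) * p i * `|x i| ^+ 2
    - \sum_i (x i)^*%R * \sum_k g i k * (p k * x k)
  = 2^-1 * \sum_k \sum_i g k i * p i * `|x i - x k| ^+ 2.
  set Q := (X in X - _ = _); set S := (X in _ - X = _).
  have Q1 : Q = \sum_k \sum_i g k i * p i * (x i * (x i)^*%R).
    rewrite exchange_big; apply: eq_bigr => i _; rewrite normCK !mulr_suml.
    by [].
  have Q2 : Q = \sum_k \sum_i g k i * p i * (x k * (x k)^*%R).
    rewrite Q1 exchange_big; apply: eq_bigr => i _; apply: eq_bigr => k _.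
    by rewrite gC.
  have S1 : S = \sum_k \sum_i g k i * p i * ((x k)^*%R * x i).
    by apply: eq_bigr => k _; rewrite mulr_sumr; apply: eq_bigr => i _; ring.
  have S2 : S = \sum_k \sum_i g k i * p i * (x k * (x i)^*%R).
    rewrite S1 exchange_big; apply: eq_bigr => i _; apply: eq_bigr => k _.
    by rewrite gC; ring.
  (* Each of [Q] and [S] is used once in either order of its indices; the four terms together are
     the expansion of [|x i - x k|^2]. *)
  have -> : Q - S = 2^-1 * (Q + Q - S - S) by field.
  congr (_ * _).
  rewrite {1}Q1 Q2 {1}S1 S2 -big_split -!sumrB /=; apply: eq_bigr => k _.
  rewrite -big_split -!sumrB /=; apply: eq_bigr => i _.
  by rewrite normCK rmorphB /=; ring.
rewrite (_ : e / 2 * #|L|%:R * _ =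
    2^-1 * \sum_(k in L) e * \sum_i p i * `|x i - mu| ^+ 2).
  rewrite ler_wpM2l ?invr_ge0 //.
  rewrite [leRHS](bigID (mem L)) /=.
  rewrite -[leLHS]addr0 lerD //; last first.
    by apply: sumr_ge0 => k _; apply: sumr_ge0 => i _; rewrite !mulr_ge0 ?exprn_ge0.
  apply: ler_sum => k kL.
  apply: le_trans (ler_wpM2l e0 (weighted_variance_le (x k) muE p1 p0)) _.
  rewrite mulr_sumr; apply: ler_sum => i _; rewrite mulrA ler_wpM2r ?exprn_ge0 //.
  by rewrite ler_wpM2r ?gL.
by rewrite sumr_const -mulr_natr; ring.
Qed.

(** With [s] the square roots of the weights, the left side carries the KMS variance and the right
    side is the quadratic form of the averaged generator. Both split into a diagonal part, where
    [dirichlet_form_ge] applies, and an off-diagonal part, which is compared entry by entry. *)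
Lemma davies_form_ge g D p s (x : I -> I -> C) (mu e : C) (L : {set I}) :
  mu = \sum_i p i * x i i -> \sum_i p i = 1 ->
  (forall i, 0 <= s i) -> (forall i, p i = s i * s i) ->
  (forall i k, 0 <= g i k) -> 0 <= e ->
  (forall i k, g i k * p k = g k i * p i) ->
  (forall i k, k \in L -> e <= g k i) ->
  (forall i, D i = \sum_k g k i) ->
  e / 2 * #|L|%:R
    * \sum_i \sum_j s i * s j * `|x i j - (i == j)%:R * mu| ^+ 2 <=
  \sum_i \sum_j (D i + D j) / 2 * (s i * s j) * `|x i j| ^+ 2
    - \sum_i (x i i)^*%R * \sum_k g i k * (p k * x k k).
Proof.
move=> muE p1 s0 pE g0 e0 gC gL DE.
have p0 i : 0 <= p i by rewrite pE mulr_ge0.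
have D_ge i : e * #|L|%:R <= D i.
  rewrite DE (bigID (mem L)) /= -[leLHS]addr0 lerD ?sumr_ge0 //.
  by rewrite mulr_natr -sumr_const ler_sum // => k /gL.
have -> : \sum_i \sum_j s i * s j * `|x i j - (i == j)%:R * mu| ^+ 2
   = \sum_i p i * `|x i i - mu| ^+ 2
     + \sum_i \sum_(j | j != i) s i * s j * `|x i j| ^+ 2.
  rewrite -big_split; apply: eq_bigr => i _ /=; rewrite (bigD1 i) //= eqxx mul1r pE.
  congr (_ + _); apply: eq_bigr => j /negPf; rewrite eq_sym => ->.
  by rewrite mul0r subr0.
have -> : \sum_i \sum_j (D i + D j) / 2 * (s i * s j) * `|x i j| ^+ 2
   = \sum_i D i * p i * `|x i i| ^+ 2
     + \sum_i \sum_(j | j != i) (D i + D j) / 2 * (s i * s j) * `|x i j| ^+ 2.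
  rewrite -big_split; apply: eq_bigr => i _ /=; rewrite (bigD1 i) //= pE.
  by congr (_ + _); field.
rewrite mulrDr addrAC lerD //.
  under [X in _ <= X - _]eq_bigr => i _ do rewrite DE.
  exact: dirichlet_form_ge.
rewrite mulr_sumr; apply: ler_sum => i _.
rewrite mulr_sumr; apply: ler_sum => j _.
rewrite mulrA ler_wpM2r ?exprn_ge0 // ler_wpM2r ?mulr_ge0 //.
(* Bounding [D i] by [e * #|L|] and [D j] by 0 already gives the constant reached on the
   diagonal. *)
have -> : e / 2 * #|L|%:R = (e * #|L|%:R + 0) / 2 by field.
by rewrite ler_wpM2r ?invr_ge0 // lerD // (le_trans _ (D_ge j)) // mulr_ge0.
Qed.

End Poincare.

(** * Integration of complex-valued functions *)

Section ComplexIntegral.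
Context {R : realType} {d : measure_display} {T : measurableType d}.
Variable mu : {measure set T -> \bar R}.
Local Notation C := R[i].
Implicit Types (g h : T -> C) (v w c : C).

Definition cmeasurable g :=
  measurable_fun setT (fun x => complex.Re (g x)) /\
  measurable_fun setT (fun x => complex.Im (g x)).

Lemma cmeasurable_cst c : cmeasurable (fun=> c).
Proof. by split; exact: measurable_cst. Qed.

Lemma cmeasurableM g h :
  cmeasurable g -> cmeasurable h -> cmeasurable (fun x => g x * h x).
Proof.
move=> [gr gi] [hr hi]; split.
  rewrite (_ : (fun x => _) = fun x => complex.Re (g x) * complex.Re (h x)
                                  - complex.Im (g x) * complex.Im (h x)).
    by apply: measurable_funB; apply: measurable_funM.
  by apply/funext => x; case: (g x) (h x) => a b [].
rewrite (_ : (fun x => _) = fun x => complex.Re (g x) * complex.Im (h x)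
                                  + complex.Im (g x) * complex.Re (h x)).
  by apply: measurable_funD; apply: measurable_funM.
by apply/funext => x; case: (g x) (h x) => a b [].
Qed.

Lemma cmeasurable_sum (I : Type) (r : seq I) (G : I -> T -> C) :
  (forall i, cmeasurable (G i)) -> cmeasurable (fun x => \sum_(i <- r) G i x).
Proof.
move=> mG; split.
  rewrite (_ : (fun x => _) = fun x => \sum_(i <- r) complex.Re (G i x)).
    by apply: measurable_sum => i; case: (mG i).
  by apply/funext => x; rewrite (raddf_sum (@complex.Re R : Rcomplex R -> R)).
rewrite (_ : (fun x => _) = fun x => \sum_(i <- r) complex.Im (G i x)).
  by apply: measurable_sum => i; case: (mG i).
by apply/funext => x; rewrite (raddf_sum (@complex.Im R : Rcomplex R -> R)).
Qed.

Lemma cmeasurable_conj g : cmeasurable g -> cmeasurable (fun x => (g x)^*%R).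
Proof.
move=> [gr gi]; split.
  rewrite (_ : (fun x => _) = fun x => complex.Re (g x)) //.
  by apply/funext => x; case: (g x).
rewrite (_ : (fun x => _) = fun x => - complex.Im (g x)).
  exact: measurableT_comp.
by apply/funext => x; case: (g x).
Qed.

Lemma cmeasurable_matrix_element {N : nat} (G : T -> 'M[C]_N) (u v : 'cV[C]_N) :
  mxmeasurable G -> cmeasurable (fun x => matrix_element u (G x) v).
Proof.
move=> mG; rewrite /matrix_element.
rewrite (_ : (fun x => _) = fun x => \sum_j (\sum_k (u k 0)^*%R * G x k j) * v j 0).
  apply: cmeasurable_sum => j; apply: cmeasurableM; last exact: cmeasurable_cst.
  apply: cmeasurable_sum => k; apply: cmeasurableM; first exact: cmeasurable_cst.
  exact: mG.
apply/funext => x; rewrite mxE; apply: eq_bigr => j _; rewrite mxE; congr (_ * _).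
by apply: eq_bigr => k _; rewrite !mxE.
Qed.

Lemma integrable_EFinD (p q : T -> R) :
  mu.-integrable setT (EFin \o p) -> mu.-integrable setT (EFin \o q) ->
  mu.-integrable setT (EFin \o (fun x => p x + q x)).
Proof. by move=> ip iq; exact: (integrableD measurableT ip iq). Qed.

Lemma integrable_EFinZ (k : R) (p : T -> R) :
  mu.-integrable setT (EFin \o p) ->
  mu.-integrable setT (EFin \o (fun x => k * p x)).
Proof. by move=> ip; exact: (integrableZl measurableT k ip). Qed.

(** Integrability is carried along with the value, because the linearity rules for the integral
    require it. *)
Definition has_cintegral g v := cintegrable mu g /\ cintegral mu g = v.

Lemma has_cintegralZ c g v : has_cintegral g v -> has_cintegral (fun x => c * g x) (c * v).
Proof.
case: c => a b [[gr gi] <-].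
have E x : (a +i* b) * g x = (a * complex.Re (g x) + (- b) * complex.Im (g x)) +i*
    (a * complex.Im (g x) + b * complex.Re (g x)).
  by case: (g x) => p q /=; rewrite mulNr.
have Re_E : (fun x => complex.Re ((a +i* b) * g x))
    = fun x => a * complex.Re (g x) + - b * complex.Im (g x).
  by apply/funext => x; rewrite E.
have Im_E : (fun x => complex.Im ((a +i* b) * g x))
    = fun x => a * complex.Im (g x) + b * complex.Re (g x).
  by apply/funext => x; rewrite E.
rewrite /has_cintegral /cintegrable /cintegral Re_E Im_E; split.
  by split; apply: integrable_EFinD; apply: integrable_EFinZ.
rewrite !RintegralD ?RintegralZl //; try exact: integrable_EFinZ.
by rewrite mulNr.
Qed.

Lemma has_cintegralD g h v w : has_cintegral g v -> has_cintegral h w ->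
  has_cintegral (fun x => g x + h x) (v + w).
Proof.
move=> [[gr gi] <-] [[hr hi] <-].
have Re_E : (fun x => complex.Re (g x + h x))
    = fun x => complex.Re (g x) + complex.Re (h x).
  by apply/funext => x; case: (g x) (h x) => ? ? [].
have Im_E : (fun x => complex.Im (g x + h x))
    = fun x => complex.Im (g x) + complex.Im (h x).
  by apply/funext => x; case: (g x) (h x) => ? ? [].
rewrite /has_cintegral /cintegrable /cintegral Re_E Im_E; split.
  by split; exact: integrable_EFinD.
by rewrite !RintegralD.
Qed.

Lemma has_cintegral0 : has_cintegral (fun=> 0) 0.
Proof.
split; first by split; exact: integrable0.
by rewrite /cintegral !Rintegral_cst // !mul0r.
Qed.

Lemma has_cintegral_sum (I : Type) (r : seq I) (G : I -> T -> C) (w : I -> C) :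
  (forall i, has_cintegral (G i) (w i)) ->
  has_cintegral (fun x => \sum_(i <- r) G i x) (\sum_(i <- r) w i).
Proof.
move=> hG; elim: r => [|i r IH].
  rewrite big_nil (_ : (fun x => _) = fun=> 0); first exact: has_cintegral0.
  by apply/funext => x; rewrite big_nil.
rewrite big_cons (_ : (fun x => _) = fun x => G i x + \sum_(i <- r) G i x).
  exact: has_cintegralD.
by apply/funext => x; rewrite big_cons.
Qed.

Lemma norm_imaginary : `|'i%C : C| = 1.
Proof. by rewrite normc_def /= expr0n expr1n add0r sqrtr1. Qed.

Lemma cintegrable_le (G : T -> R) h : mu.-integrable setT (EFin \o G) ->
  cmeasurable h -> (forall x, `|h x| <= (G x)%:C) -> cintegrable mu h.
Proof.
move=> iG [hr hi] hG.
have dom (k : T -> R) : measurable_fun setT k -> (forall x, `|k x|%:C <= `|h x|) ->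
    mu.-integrable setT (EFin \o k).
  move=> mk kh; apply: le_integrable iG => //; first exact/measurable_EFinP.
  move=> x _ /=; rewrite lee_fin (le_trans _ (ler_norm _)) //.
  by rewrite -lecR (le_trans (kh x)).
split; apply: dom => // x; first exact: normc_ge_Re.
(* Multiplication by ['i] preserves the modulus, so the bound on real parts also covers imaginary
   parts. *)
have -> : complex.Im (h x) = - complex.Re (h x * 'i%C) by rewrite ReiNIm opprK.
by rewrite normrN (le_trans (normc_ge_Re _)) // normrM norm_imaginary mulr1.
Qed.

(* An infinite integral would have the junk value [fine +oo = 0], so a positive
   value of [cintegral] is already a proof of integrability. *)
Lemma sqr_norm_cintegrable g : cmeasurable g ->
  0 < complex.Re (cintegral mu (fun x => g x * (g x)^*%R)) ->
  mu.-integrable setT (EFin \o (fun x => complex.Re (g x * (g x)^*%R))).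
Proof.
move=> mg; rewrite /cintegral /Rintegral /= => pos.
have [mgg _] := cmeasurableM mg (cmeasurable_conj mg).
apply/integrableP; split; first exact/measurable_EFinP.
under eq_integral.
  move=> x _; rewrite /= ger0_norm.
    over.
  by case: (g x) => a b /=; rewrite mulrN opprK addr_ge0 // -expr2 sqr_ge0.
rewrite ltey; apply/eqP => E; move: pos.
by rewrite E /= ltxx.
Qed.

End ComplexIntegral.

(** * Fourier integrals of an integrable weight *)

Section Fourier.
Context {R : realType}.
Local Notation C := R[i].

Lemma cexpiD (s t : R) : cexpi (s + t) = cexpi s * cexpi t :> C.
Proof. by rewrite /cexpi cosD sinD; congr (_ +i* _); ring. Qed.

Lemma norm_cexpi (t : R) : `|cexpi t : C| = 1.
Proof. by rewrite normc_def /= cos2Dsin2 sqrtr1. Qed.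

(** The phase has modulus 1, so [|Re f| + |Im f|] dominates the integrand. *)
Lemma has_cintegral_fourier (f : R -> C) (w : R) :
  cintegrable lebesgue_measure f ->
  has_cintegral lebesgue_measure (fun s => f s * cexpi (w * s)) (fourier f w).
Proof.
move=> [fr fi]; split; last by [].
have := integrable_EFinD (integrable_norm fr) (integrable_norm fi).
move=> /cintegrable_le; apply.
- apply: cmeasurableM.
    by split; apply/measurable_EFinP; [case/integrableP: fr | case/integrableP: fi].
  by split; apply: continuous_measurable_fun => s; apply: continuous_comp;
    [exact: mulrl_continuous | exact: continuous_cos
    |exact: mulrl_continuous | exact: continuous_sin].
move=> s; rewrite normrM norm_cexpi mulr1 {1}(complexE (f s)).
rewrite (le_trans (ler_normD _ _)) // normrM norm_imaginary mul1r rmorphD /=.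
by rewrite !normc_def /= !expr0n /= !addr0 !sqrtr_sqr.
Qed.

End Fourier.

(** * Operators written in an orthonormal basis *)

Section UnitaryFrame.
Context {R : realType} {N : nat}.
Local Notation C := R[i].
Implicit Types (U K M S X Y rho : 'M[C]_N).

Definition frame_mx (psi : 'I_N -> 'cV[C]_N) : 'M[C]_N := \matrix_(k, i) psi i k 0.

Lemma frame_mx_unitary psi : orthonormal_family psi ->
  (frame_mx psi)^t* *m frame_mx psi = 1%:M.
Proof.
move=> o; apply/matrixP => i j; rewrite !mxE -(o i j) /braket mxE.
by apply: eq_bigr => k _; rewrite !mxE.
Qed.

Lemma matrix_element_frame psi M i j :
  matrix_element (psi i) M (psi j) = ((frame_mx psi)^t* *m M *m frame_mx psi) i j.
Proof.
rewrite /matrix_element !mxE; apply: eq_bigr => k _; rewrite !mxE; congr (_ * _).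
by apply: eq_bigr => l _; rewrite !mxE.
Qed.

Lemma trmxCM (m n p : nat) (X : 'M[C]_(m, n)) (Y : 'M[C]_(n, p)) :
  (X *m Y)^t* = Y^t* *m X^t*.
Proof. by rewrite trmx_mul map_mxM. Qed.

Lemma hs_innerC X Y : (hs_inner X Y)^*%R = hs_inner Y X.
Proof.
rewrite !hs_innerE rmorph_sum; apply: eq_bigr => i _; rewrite rmorph_sum.
by apply: eq_bigr => j _; rewrite rmorphM /= conjCK mulrC.
Qed.

(** Cyclicity of the trace moves both square roots onto the left argument. [S] is a parameter so
    that an explicit diagonal form of the root can be substituted. *)
Lemma kms_inner_hs sigma S X Y :
  funcalc (fun x => (Num.sqrt x)%:C) sigma = S -> S^t* = S ->
  kms_inner sigma X Y = hs_inner (S *m X *m S) Y.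
Proof.
move=> SE SJ; rewrite /kms_inner /hs_inner SE.
by rewrite !trmxCM SJ mxtrace_mulC !mulmxA.
Qed.

Lemma diag_mx_sandwich (a b : 'rV[C]_N) M i j :
  (diag_mx a *m M *m diag_mx b) i j = a 0 i * M i j * b 0 j.
Proof. by rewrite mul_mx_diag mxE mul_diag_mx mxE. Qed.

Section Conjugation.
Variable U : 'M[C]_N.
Hypothesis UU : U^t* *m U = 1%:M.

Let UUV : U *m U^t* = 1%:M := mulmx1C UU.

(** Passes from the matrix of an operator in the basis of columns of [U] to the operator itself. *)
Definition conjU M := U *m M *m U^t*.

Lemma conjUM X Y : conjU X *m conjU Y = conjU (X *m Y).
Proof. by rewrite /conjU -!mulmxA (mulmxA (U^t*)) UU mul1mx. Qed.

Lemma conjUE M k l :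
  conjU M k l = \sum_j \sum_i U k i * M i j * (U l j)^*%R.
Proof.
rewrite mxE; apply: eq_bigr => j _; rewrite !mxE mulr_suml.
by apply: eq_bigr.
Qed.

Lemma conjU_trmxC M : (conjU M)^t* = conjU (M^t*).
Proof. by rewrite /conjU !trmxCM trmxCK mulmxA. Qed.

Lemma conjUK M : U^t* *m conjU M *m U = M.
Proof. by rewrite /conjU !mulmxA UU mul1mx -mulmxA UU mulmx1. Qed.

Lemma conjUVK M : conjU (U^t* *m M *m U) = M.
Proof. by rewrite /conjU !mulmxA UUV mul1mx -mulmxA UUV mulmx1. Qed.

Lemma conjU_scalar (a : C) : conjU a%:M = a%:M.
Proof. by rewrite /conjU mul_mx_scalar -scalemxAl UUV scalemx1. Qed.

Lemma conjUD X Y : conjU (X + Y) = conjU X + conjU Y.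
Proof. by rewrite /conjU mulmxDr mulmxDl. Qed.

Lemma conjUB X Y : conjU (X - Y) = conjU X - conjU Y.
Proof. by rewrite /conjU mulmxBr mulmxBl. Qed.

Lemma conjUZ a X : conjU (a *: X) = a *: conjU X.
Proof. by rewrite /conjU -scalemxAr -scalemxAl. Qed.

Lemma mxtrace_conjU X : \tr (conjU X) = \tr X.
Proof. by rewrite /conjU -mulmxA mxtrace_mulC -mulmxA UU mulmx1. Qed.

Lemma hs_inner_conjU X Y : hs_inner (conjU X) (conjU Y) = hs_inner X Y.
Proof. by rewrite /hs_inner conjU_trmxC conjUM mxtrace_conjU. Qed.

Lemma lindblad_conjU K rho :
  lindblad (conjU K) (conjU rho) = conjU (lindblad K rho).
Proof.
by rewrite /lindblad conjU_trmxC !conjUM -!conjUD -conjUZ -conjUB.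
Qed.

(** Each entry of [conjU (G x)] is a fixed finite linear combination of entries of [G x], so
    linearity of the integral suffices. *)
Lemma mxintegral_conjU {d : measure_display} {T : measurableType d}
    (mu : {measure set T -> \bar R}) (G : T -> 'M[C]_N) M :
  (forall i j, has_cintegral mu (fun x => G x i j) (M i j)) ->
  mxintegral mu (fun x => conjU (G x)) = conjU M.
Proof.
move=> hG; apply/matrixP => k l; rewrite mxE conjUE.
under eq_fun do rewrite conjUE.
suff [] : has_cintegral mu (fun x => \sum_j \sum_i U k i * G x i j * (U l j)^*%R)
  (\sum_j \sum_i U k i * M i j * (U l j)^*%R) by [].
apply: has_cintegral_sum => j; apply: has_cintegral_sum => i.
under eq_fun do rewrite mulrAC.
by rewrite mulrAC; exact: has_cintegralZ.
Qed.

End Conjugation.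

(** The eigenvalues [c] are complex so that the lemma also serves for functions of [H], such as its
    evolution operators. *)
Lemma eigen_conjU psi M (c : 'I_N -> C) : orthonormal_family psi ->
  (forall i, M *m psi i = c i *: psi i) ->
  M = conjU (frame_mx psi) (diag_mx (\row_i c i)).
Proof.
move=> o Mpsi.
have E : M *m frame_mx psi = frame_mx psi *m diag_mx (\row_i c i).
  apply/matrixP => k i; rewrite mul_mx_diag !mxE mulrC.
  have /matrixP/(_ k 0) := Mpsi i; rewrite !mxE => <-.
  by apply: eq_bigr => l _; rewrite mxE.
by rewrite /conjU -E -mulmxA (mulmx1C (frame_mx_unitary o)) mulmx1.
Qed.

Lemma conjU_diag_hermsym U (c : 'I_N -> R) :
  conjU U (diag_mx (\row_i (c i)%:C)) \is hermsymmx.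
Proof.
apply/is_hermitianmxP; rewrite expr0 scale1r -[RHS]/(_^t*) conjU_trmxC.
congr conjU; apply/matrixP => i j; rewrite !mxE.
rewrite [j == i]eq_sym; case: eqVneq => [->|_]; rewrite /= ?mulr1n ?mulr0n.
  exact/esym/conjc_real.
by rewrite rmorph0.
Qed.

(** Isolates the products of an entry of [K] with a conjugate entry, whose means over the ensemble
    are known. *)
Lemma lindblad_sum K rho i j :
  lindblad K rho i j =
    \sum_l \sum_k rho k l * (K i k * (K j l)^*%R)
  + - 2^-1 * (\sum_k \sum_m rho k j * (K m k * (K m i)^*%R)
            + \sum_k \sum_m rho i k * (K m j * (K m k)^*%R)).
Proof.
rewrite /lindblad !mxE; congr (_ + _).
  apply: eq_bigr => l _; rewrite !mxE mulr_suml; apply: eq_bigr => k _.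
  by ring.
rewrite mulNr; congr (- (_ * (_ + _))); apply: eq_bigr => k _; rewrite !mxE.
  by rewrite mulr_suml; apply: eq_bigr => m _; rewrite !mxE; ring.
by rewrite mulr_sumr; apply: eq_bigr => m _; rewrite !mxE; ring.
Qed.

(* [r i j] is the rate of the jump from level [j] to level [i]. *)
Definition davies_mx (r : 'I_N -> 'I_N -> C) rho : 'M[C]_N :=
  \matrix_(i, j) ((i == j)%:R * \sum_k r i k * rho k k
                  - (\sum_k r k i + \sum_k r k j) / 2 * rho i j).

Lemma sum_delta (F : 'I_N -> C) i : \sum_j F j * (i == j)%:R = F i.
Proof.
rewrite (bigD1 i) //= eqxx mulr1 big1 ?addr0 // => j /negPf.
by rewrite eq_sym => ->; rewrite mulr0.
Qed.

(** Uncorrelated entries leave of the jump term only transfers between diagonal entries, and of the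
    anticommutator only multiplication of each entry by the mean of two exit rates. *)
Lemma has_cintegral_lindblad {d : measure_display} {T : measurableType d}
    (mu : {measure set T -> \bar R}) (K : T -> 'M[C]_N) (r : 'I_N -> 'I_N -> C) rho :
  (forall i j k l, has_cintegral mu (fun a => K a i j * (K a l k)^*%R)
     (r i j * (i == l)%:R * (j == k)%:R)) ->
  forall i j, has_cintegral mu (fun a => lindblad (K a) rho i j) (davies_mx r rho i j).
Proof.
move=> hK i j; under eq_fun do rewrite lindblad_sum.
rewrite mxE.
(* The target is expanded back into the double sums of [lindblad_sum], each product of entries being
   replaced by its mean, so that integration proceeds term by term. *)
have -> : (i == j)%:R * \sum_k r i k * rho k k
   = \sum_l \sum_k rho k l * (r i k * (i == j)%:R * (k == l)%:R).
  rewrite exchange_big mulr_sumr; apply: eq_bigr => k _ /=.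
  rewrite (eq_bigr (fun l => rho k l * (r i k * (i == j)%:R) * (k == l)%:R)).
    by rewrite sum_delta; ring.
  by move=> l _; ring.
have -> : - ((\sum_k r k i + \sum_k r k j) / 2 * rho i j)
   = - 2^-1 * (\sum_k \sum_m rho k j * (r m k * (m == m)%:R * (k == i)%:R)
            + \sum_k \sum_m rho i k * (r m j * (m == m)%:R * (j == k)%:R)).
  have -> : \sum_k \sum_m rho k j * (r m k * (m == m)%:R * (k == i)%:R)
      = (\sum_m r m i) * rho i j.
    rewrite -[RHS](sum_delta (fun k => (\sum_m r m k) * rho k j)).
    apply: eq_bigr => k _; rewrite !mulr_suml; apply: eq_bigr => m _.
    by rewrite eqxx [k == i]eq_sym /=; ring.
  have -> : \sum_k \sum_m rho i k * (r m j * (m == m)%:R * (j == k)%:R)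
      = (\sum_m r m j) * rho i j.
    rewrite -[RHS](sum_delta (fun k => (\sum_m r m j) * rho i k)).
    apply: eq_bigr => k _; rewrite !mulr_suml; apply: eq_bigr => m _.
    by rewrite eqxx /=; ring.
  by ring.
apply: has_cintegralD.
  do 2![apply: has_cintegral_sum => ?]; exact: has_cintegralZ.
apply: has_cintegralZ; apply: has_cintegralD;
  do 2![apply: has_cintegral_sum => ?]; exact: has_cintegralZ.
Qed.

End UnitaryFrame.

(** * Integrability of products from second moments *)

Section CovarianceIntegrability.
Context {R : realType} {d : measure_display} {T : measurableType d}.
Variable mu : {measure set T -> \bar R}.
Local Notation C := R[i].

Lemma Re_mul_conj (z : C) : (complex.Re (z * z^*%R))%:C = `|z| ^+ 2.
Proof.
rewrite normCK; case: z => a b; apply/eqP; rewrite eq_complex /= eqxx /=.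
by apply/eqP; ring.
Qed.

Lemma mulr_norm_le (x y : C) : `|x| * `|y| <= `|x| ^+ 2 + `|y| ^+ 2.
Proof.
case/orP: (real_leVge (normr_real x) (normr_real y)) => xy; rewrite !expr2.
  by rewrite -[leLHS]add0r lerD ?mulr_ge0 // ler_wpM2r.
by rewrite -[leLHS]addr0 lerD ?mulr_ge0 // ler_wpM2l.
Qed.

(** The product is dominated by [|g|^2 + |h|^2]. This covers cross terms of mean zero, for which the
    value of [cintegral] says nothing about integrability. *)
Lemma cross_cintegrable (g h : T -> C) : cmeasurable g -> cmeasurable h ->
  0 < complex.Re (cintegral mu (fun x => g x * (g x)^*%R)) ->
  0 < complex.Re (cintegral mu (fun x => h x * (h x)^*%R)) ->
  cintegrable mu (fun x => g x * (h x)^*%R).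
Proof.
move=> mg mh g0 h0.
apply: cintegrable_le
  (integrable_EFinD (sqr_norm_cintegrable mg g0) (sqr_norm_cintegrable mh h0)) _ _.
  exact: cmeasurableM mg (cmeasurable_conj mh).
by move=> x; rewrite rmorphD /= !Re_mul_conj normrM norm_conjC mulr_norm_le.
Qed.

End CovarianceIntegrability.

(** * The averaged generator in the eigenbasis of [H] *)

Section Davies.
Context {R : realType} {N : nat}.
Local Notation C := R[i].
Variables (H : 'M[C]_N) (lambda : 'I_N -> R) (psi : 'I_N -> 'cV[C]_N).
Hypotheses (hH : H \is hermsymmx) (psiO : orthonormal_family psi)
  (psiE : forall i, H *m psi i = (lambda i)%:C *: psi i).
Let U := frame_mx psi.
Let UU : U^t* *m U = 1%:M := frame_mx_unitary psiO.

(** A row eigenvector [v] has some nonzero coordinate in the basis; comparing that coordinate in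
    [v H = x v] identifies [x]. *)
Lemma spec_lambda x : spec H x -> exists i, x = lambda i.
Proof.
case/eigenvalueP => v vH v0.
have [i vi] : exists i, (v *m U) 0 i != 0.
  apply/existsP; apply: contraNT v0 => /existsPn vU0.
  rewrite -[v]mulmx1 -(mulmx1C UU) mulmxA.
  rewrite (_ : v *m U = 0) ?mul0mx //; apply/rowP => i; rewrite [RHS]mxE.
  by apply/eqP; rewrite -[_ == _]negbK; exact: vU0.
exists i; apply: complexI; apply: (mulIf vi).
have := congr1 (fun w : 'rV_N => (w *m U) 0 i) vH.
rewrite -scalemxAl [in RHS]mxE => <-.
rewrite {1}(eigen_conjU psiO psiE) /conjU -/U !mulmxA -[_ *m U^t* *m U]mulmxA UU mulmx1.
by rewrite mul_mx_diag !mxE mulrC.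
Qed.

Lemma lambda_spec i : spec H (lambda i).
Proof.
apply/eigenvalueP; exists ((psi i)^t*).
  have HJ : H^t* = H by move/is_hermitianmxP: hH; rewrite expr0 scale1r => <-.
  rewrite -{1}HJ -trmxCM psiE linearZ /= map_mxZ; congr (_ *: _).
  exact: conjc_real.
apply/eqP => psi0; have := psiO i i; rewrite /braket psi0 mul0mx mxE eqxx /=.
by move/eqP; rewrite eq_sym oner_eq0.
Qed.

Lemma lambda_min_le i : lambda_min H <= lambda i.
Proof.
(* The infimum lies below every member only for a set bounded below, hence the explicit bound. *)
apply: ge_inf (lambda_spec i); exists (- \sum_j `|lambda j|) => x /spec_lambda[j ->].
rewrite lerNl (le_trans (ler_norm _)) // normrN (bigD1 j) //= lerDl.
by rewrite sumr_ge0.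
Qed.

Lemma funcalc_conjU (g : R -> C) :
  funcalc g H = conjU U (diag_mx (\row_i g (lambda i))).
Proof. by apply: (eigen_conjU psiO) => i; exact: funcalc_eigen. Qed.

(** The evolution is diagonal in this basis, so it multiplies entry [(i, j)] of [A] by a phase of
    frequency [lambda i - lambda j]; integrating against [f] gives the Fourier transform there. *)
Lemma filtered_conjU (f : R -> C) (A : 'M[C]_N) :
  cintegrable lebesgue_measure f ->
  filtered f H A = conjU U
    (\matrix_(i, j) (fourier f (lambda i - lambda j) * matrix_element (psi i) A (psi j))).
Proof.
move=> fI; rewrite /filtered.
pose G s : 'M[C]_N := \matrix_(i, j) (matrix_element (psi i) A (psi j)
   * (f s * cexpi ((lambda i - lambda j) * s))).
rewrite (_ : (fun s => _) = fun s => conjU U (G s)).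
  apply: mxintegral_conjU => i j; under eq_fun do rewrite mxE.
  by rewrite mxE mulrC; apply: has_cintegralZ; exact: has_cintegral_fourier.
apply/funext => s; rewrite /evolution !funcalc_conjU -[A in LHS](conjUVK UU).
rewrite !conjUM // -conjUZ; congr conjU; apply/matrixP => i j.
rewrite [LHS]mxE diag_mx_sandwich -matrix_element_frame !mxE.
by rewrite mulrBl cexpiD -mulrN; ring.
Qed.

Lemma mean_lindblad_conjU {d : measure_display} {T : measurableType d}
    (P : probability T R) (A : T -> 'M[C]_N) (xi : R) (f : R -> C)
    (g : R -> R) rho :
  mxmeasurable A -> 0 < xi ->
  (forall i j k l, cintegral P (fun a => matrix_element (psi i) (A a) (psi j)
                             * (matrix_element (psi l) (A a) (psi k))^*%R)
       = (xi ^+ 2)%:C * (i == l)%:R * (j == k)%:R) ->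
  cintegrable lebesgue_measure f ->
  (forall w, bohr_freq H w -> fourier f w = (Num.sqrt (g w))%:C) ->
  (forall w, 0 <= g w) ->
  mean_lindblad P f H A (conjU U rho) =
  conjU U (davies_mx (fun i j => (xi ^+ 2 * g (lambda i - lambda j))%:C) rho).
Proof.
move=> mA xi0 covA fI fF g0; rewrite /mean_lindblad.
under eq_fun do rewrite filtered_conjU // lindblad_conjU //.
apply: mxintegral_conjU; apply: has_cintegral_lindblad => i j k l.
have fE p q : fourier f (lambda p - lambda q) = (Num.sqrt (g (lambda p - lambda q)))%:C.
  by apply: fF; exists (lambda p), (lambda q); split=> //; exact: lambda_spec.
have mB p q := cmeasurable_matrix_element (psi p) (psi q) mA.
(* Every entry of [A] has second moment [xi ^+ 2 > 0]; this positivity yields the integrability of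
   all the cross products. *)
have posB p q : 0 < complex.Re (cintegral P
    (fun a => matrix_element (psi p) (A a) (psi q)
              * (matrix_element (psi p) (A a) (psi q))^*%R)).
  by rewrite covA !eqxx !mulr1 /= exprn_gt0.
pose c : C :=
  (Num.sqrt (g (lambda i - lambda j)) * Num.sqrt (g (lambda l - lambda k)))%:C.
pose K a : 'M[C]_N := \matrix_(i, j)
  (fourier f (lambda i - lambda j) * matrix_element (psi i) (A a) (psi j)).
have iB := cross_cintegrable (mB i j) (mB l k) (posB i j) (posB l k).
have := has_cintegralZ c (conj iB (covA i j k l)).
rewrite (_ : c * _ =
    (xi ^+ 2 * g (lambda i - lambda j))%:C * (i == l)%:R * (j == k)%:R).
  rewrite (_ : (fun a => c * _) = fun a => K a i j * (K a l k)^*%R) //.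
  apply/funext => a; rewrite !mxE !fE rmorphM /= /c rmorphM /=.
  have -> : ((Num.sqrt (g (lambda l - lambda k)))%:C)^*%R
     = (Num.sqrt (g (lambda l - lambda k)))%:C :> C by exact: conjc_real.
  by ring.
(* Both sides vanish unless [i = l] and [j = k], and then the two square roots multiply to
   [g (lambda i - lambda j)]. *)
rewrite /c; case: eqVneq => [<-|_]; last by rewrite /= !(mulr0, mul0r).
case: eqVneq => [<-|_]; last by rewrite /= !mulr0.
by rewrite -expr2 sqr_sqrtr //= !mulr1 -rmorphM /= mulrC.
Qed.

End Davies.

(** * The KMS form of the adjoint generator *)

Section KMSAdjoint.
Context {R : realType} {N : nat}.
Local Notation C := R[i].

(** Evaluates the numerator of the Rayleigh quotient from [L] itself, without computing its
    adjoint. *)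
Lemma kms_inner_adjoint (sigma S X : 'M[C]_N) (L : {linear 'M[C]_N -> 'M[C]_N}) :
  funcalc (fun x => (Num.sqrt x)%:C) sigma = S -> S^t* = S ->
  kms_inner sigma X (hs_adjoint L X) = (hs_inner X (L (S *m X *m S)))^*%R.
Proof.
move=> SE SJ; rewrite (kms_inner_hs _ _ SE SJ).
by rewrite -hs_innerC hs_adjointP.
Qed.

Lemma davies_mx_linear (r : 'I_N -> 'I_N -> C) : linear (davies_mx r).
Proof.
move=> a X Y; apply/matrixP => i j; rewrite !mxE.
rewrite (eq_bigr (fun k => a * (r i k * X k k) + r i k * Y k k)).
  by rewrite big_split -mulr_sumr /=; ring.
by move=> k _; rewrite !mxE; ring.
Qed.

End KMSAdjoint.

(** * Gibbs weights and Metropolis rates *)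

Section Gibbs.
Context {R : realType} {N : nat}.
Variables (beta : R) (lambda : 'I_N -> R).
Hypotheses (beta_gt0 : 0 < beta) (N_gt0 : (0 < N)%N).

Definition partition_function := \sum_i expR (- (beta * lambda i)).

Definition gibbs_weight i := expR (- (beta * lambda i)) / partition_function.

Lemma partition_function_gt0 : 0 < partition_function.
Proof.
rewrite /partition_function (bigD1 (Ordinal N_gt0)) //= ltr_pwDl ?expR_gt0 //.
by rewrite sumr_ge0 // => i _; exact: expR_ge0.
Qed.

Lemma gibbs_weight_gt0 i : 0 < gibbs_weight i.
Proof. by rewrite divr_gt0 ?expR_gt0 ?partition_function_gt0. Qed.

Lemma gibbs_weight_sum : \sum_i gibbs_weight i = 1.
Proof. by rewrite -mulr_suml divff // gt_eqF ?partition_function_gt0. Qed.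

(** Up to the partition function, both sides are the minimum of the two Boltzmann factors. *)
Lemma metropolis_balance i k :
  metropolis beta (lambda i - lambda k) * gibbs_weight k
  = metropolis beta (lambda k - lambda i) * gibbs_weight i.
Proof.
suff E p q : metropolis beta (lambda p - lambda q) * expR (- (beta * lambda q))
    = Num.min (expR (- (beta * lambda q))) (expR (- (beta * lambda p))).
  by rewrite /gibbs_weight !mulrA !E minC.
rewrite /metropolis minr_pMl ?expR_ge0 // mul1r -expRD; congr (Num.min _ (expR _)).
by ring.
Qed.

Lemma metropolis_ge0 (w : R) : 0 <= metropolis beta w.
Proof. by rewrite le_min ler01 expR_ge0. Qed.

(** At [w = beta^-1] the Boltzmann factor is exactly [expR (-1)], and it decreases in [w]. *)
Lemma metropolis_low (w : R) : w <= (beta^-1)%R -> expR (-1) <= metropolis beta w.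
Proof.
move=> wb; rewrite le_min; apply/andP; split.
  by rewrite -[leRHS]expR0 ler_expR lerN10.
by rewrite ler_expR lerN2 -(divff (lt0r_neq0 beta_gt0)) ler_pM2l.
Qed.

End Gibbs.

Lemma gibbs_conjU {R : realType} {N : nat} (beta : R) (H : 'M[R[i]]_N)
    (lambda : 'I_N -> R) (psi : 'I_N -> 'cV[R[i]]_N) :
  H \is hermsymmx -> orthonormal_family psi ->
  (forall i, H *m psi i = (lambda i)%:C *: psi i) ->
  gibbs beta H = conjU (frame_mx psi) (diag_mx (\row_i (gibbs_weight beta lambda i)%:C)).
Proof.
move=> hH psiO psiE; rewrite /gibbs (funcalc_conjU hH psiO psiE).
rewrite mxtrace_conjU ?frame_mx_unitary // mxtrace_diag -conjUZ -linearZ /=.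
congr (conjU _ (diag_mx _)); apply/rowP => i; rewrite !mxE.
under eq_bigr do rewrite mxE.
by rewrite -rmorph_sum -fmorphV -rmorphM mulrC.
Qed.

(** * Comparison of the KMS form with the variance *)

Section SpectralGap.
Context {R : realType} {N : nat}.
Local Notation C := R[i].
Variables (H : 'M[C]_N) (lambda : 'I_N -> R) (psi : 'I_N -> 'cV[C]_N).
Hypotheses (hH : H \is hermsymmx) (psiO : orthonormal_family psi)
  (psiE : forall i, H *m psi i = (lambda i)%:C *: psi i).
Hypothesis N_gt0 : (0 < N)%N.
Variable beta : R.
Hypothesis beta_gt0 : 0 < beta.
Let U := frame_mx psi.
Let UU : U^t* *m U = 1%:M := frame_mx_unitary psiO.
Let p := gibbs_weight beta lambda.
Let s i : C := (Num.sqrt (p i))%:C.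
Let S := conjU U (diag_mx (\row_i s i)).
Let sigma := gibbs beta H.

Let s_gt0 i : 0 < s i.
Proof. by rewrite ltcR sqrtr_gt0 gibbs_weight_gt0. Qed.

Let ssE i : (p i)%:C = s i * s i.
Proof. by rewrite -rmorphM -expr2 sqr_sqrtr // ltW // gibbs_weight_gt0. Qed.

Let SJ : S^t* = S.
Proof.
have := conjU_diag_hermsym U (fun i => Num.sqrt (p i)).
by move/is_hermitianmxP; rewrite expr0 scale1r => <-.
Qed.

Let sigmaE : sigma = conjU U (diag_mx (\row_i (p i)%:C)).
Proof. exact: gibbs_conjU. Qed.

(** The columns of [U] are eigenvectors of [sigma], and [funcalc_eigen] applies to any eigenvector,
    whichever diagonalization [funcalc] chose. *)
Let sqrt_sigma : funcalc (fun x => (Num.sqrt x)%:C) sigma = S.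
Proof.
apply: (eigen_conjU psiO) => i; apply: funcalc_eigen.
  by rewrite sigmaE; exact: conjU_diag_hermsym.
apply/matrixP => k j; rewrite (ord1 j) sigmaE.
have /matrixP/(_ k i) : conjU U (diag_mx (\row_i (p i)%:C)) *m U
    = U *m diag_mx (\row_i (p i)%:C).
  by rewrite /conjU -mulmxA UU mulmx1.
rewrite mul_mx_diag !mxE mulrC => <-.
by apply: eq_bigr => l _; rewrite !mxE.
Qed.

Let sandwich_conjU (x : 'M[C]_N) :
  S *m conjU U x *m S = conjU U (\matrix_(i, j) (s i * x i j * s j)).
Proof.
rewrite !conjUM //; congr conjU; apply/matrixP => i j.
by rewrite diag_mx_sandwich !mxE.
Qed.

Lemma variance_kms_conjU (x : 'M[C]_N) :
  variance_kms sigma (conjU U x) =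
  \sum_i \sum_j s i * s j * `|x i j - (i == j)%:R * \sum_k (p k)%:C * x k k| ^+ 2.
Proof.
rewrite /variance_kms.
have -> : \tr (sigma *m conjU U x) = \sum_k (p k)%:C * x k k.
  rewrite sigmaE conjUM // mxtrace_conjU //; apply: eq_bigr => k _.
  by rewrite mul_diag_mx !mxE.
set m := \sum_k _; rewrite -(conjU_scalar UU) -conjUB.
rewrite (kms_inner_hs _ _ sqrt_sigma SJ) sandwich_conjU hs_inner_conjU // hs_innerE.
apply: eq_bigr => i _; apply: eq_bigr => j _; rewrite !mxE mulr_natl normCK.
rewrite !rmorphM /=.
have sJ k : (s k)^*%R = s k by exact: conjc_real.
by rewrite !sJ; ring.
Qed.

(** All weights [s i * s j] are strictly positive, so zero variance would force [x] to be [m] times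
    the identity. This permits division in the Rayleigh quotient. *)
Lemma variance_kms_gt0 (x : 'M[C]_N) : ~~ is_scalar_mx x ->
  0 < variance_kms sigma (conjU U x).
Proof.
move=> xns; rewrite variance_kms_conjU; set m := \sum_k (p k)%:C * x k k.
have t0 i j : 0 <= s i * s j * `|x i j - (i == j)%:R * m| ^+ 2.
  by rewrite !mulr_ge0 ?exprn_ge0 // ltW.
rewrite lt_def sumr_ge0 ?andbT => [|i _]; last by apply: sumr_ge0 => j _; exact: t0.
apply: contra xns => /eqP V0; apply/is_scalar_mxP; exists m.
apply/matrixP => i j; rewrite !mxE -mulr_natl; apply/eqP; rewrite -subr_eq0.
have /eqP : \sum_j s i * s j * `|x i j - (i == j)%:R * m| ^+ 2 = 0.
  by apply: (psumr_eq0P _ V0) => // k _; apply: sumr_ge0 => l _; exact: t0.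
move=> /eqP/psumr_eq0P - /(_ (fun k _ => t0 i k)) /(_ j isT) /eqP.
by rewrite expr2 !mulf_eq0 !(gt_eqF (s_gt0 _)) /= normr_eq0 orbb.
Qed.

(** Transports [davies_form_ge] to operators; [k] stands for [xi ^+ 2] and [e] for the least rate
    into a low level. *)
Lemma kms_davies_ge (x : 'M[C]_N) (k e : R) (g : R -> R)
    (L : {linear 'M[C]_N -> 'M[C]_N}) (low : {set 'I_N}) :
  0 <= k -> 0 <= e -> (forall w, 0 <= g w) ->
  (forall i j, g (lambda i - lambda j) * p j = g (lambda j - lambda i) * p i) ->
  (forall i j, j \in low -> e <= g (lambda j - lambda i)) ->
  (forall rho, L (conjU U rho) =
     conjU U (davies_mx (fun i j => (k * g (lambda i - lambda j))%:C) rho)) ->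
  (k * (e / 2) * #|low|%:R)%:C * variance_kms sigma (conjU U x)
    <= - kms_inner sigma (conjU U x) (hs_adjoint L (conjU U x)).
Proof.
move=> k0 e0 g0 gC gL LE.
rewrite (kms_inner_adjoint _ _ sqrt_sigma SJ) sandwich_conjU LE hs_inner_conjU //.
pose gam i j : C := (g (lambda i - lambda j))%:C.
pose D j : C := \sum_i gam i j.
set h := hs_inner _ _.
(* Sandwiching by [S] multiplies entry [(i, j)] by [s i * s j], which on the diagonal is the Gibbs
   weight. *)
have hE : - h = k%:C * (\sum_i \sum_j (D i + D j) / 2 * (s i * s j) * `|x i j| ^+ 2
    - \sum_i (x i i)^*%R * \sum_j gam i j * ((p j)%:C * x j j)).
  rewrite /h hs_innerE.
  have -> : \sum_i (x i i)^*%R * \sum_j gam i j * ((p j)%:C * x j j)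
    = \sum_i \sum_j (x i j)^*%R * (\sum_l gam i l * ((p l)%:C * x l l)) * (i == j)%:R.
    by apply: eq_bigr => i _; rewrite sum_delta.
  rewrite -sumrB mulr_sumr -sumrN; apply: eq_bigr => i _.
  rewrite -sumrB mulr_sumr -sumrN; apply: eq_bigr => j _.
  rewrite !mxE normCK.
  have DE q : \sum_l (k * g (lambda l - lambda q))%:C = k%:C * D q.
    by rewrite mulr_sumr; apply: eq_bigr => l _; rewrite rmorphM.
  have -> : \sum_l (k * g (lambda i - lambda l))%:C
      * (\matrix_(i, j) (s i * x i j * s j)) l l
     = k%:C * \sum_l gam i l * ((p l)%:C * x l l).
    rewrite mulr_sumr; apply: eq_bigr => l _; rewrite mxE rmorphM /= ssE /gam.
    by ring.
  by rewrite !DE; field.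
have hge : (k * (e / 2) * #|low|%:R)%:C * variance_kms sigma (conjU U x) <= - h.
  rewrite hE variance_kms_conjU.
  rewrite (_ : (k * (e / 2) * #|low|%:R)%:C = k%:C * (e%:C / 2 * #|low|%:R)); last first.
    by rewrite !rmorphM fmorphV !rmorph_nat -mulrA.
  rewrite -mulrA ler_wpM2l ?lecR //.
  apply: (davies_form_ge (g := gam) (p := fun i => (p i)%:C) (s := s)) => //.
  - by rewrite -rmorph_sum /= gibbs_weight_sum.
  - by move=> i; exact: ltW.
  - by move=> i j; rewrite lecR.
  - by rewrite lecR.
  - by move=> i j; rewrite /gam -!rmorphM /= gC.
  - by move=> i j jL; rewrite lecR gL.
have V0 : 0 <= variance_kms sigma (conjU U x).
  rewrite variance_kms_conjU; apply: sumr_ge0 => i _; apply: sumr_ge0 => j _.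
  by rewrite !mulr_ge0 ?exprn_ge0 // ltW.
have hr : 0 <= - h.
  by apply: le_trans hge; rewrite mulr_ge0 // lecR !mulr_ge0 ?invr_ge0.
(* The bound just proved makes [- h] nonnegative, hence real, which removes the conjugate left by
   [kms_inner_adjoint]. *)
have hJ : (- h)^*%R = - h by apply: CrealP; exact: ger0_real.
by rewrite -rmorphN /= hJ.
Qed.

End SpectralGap.

(** * The lower bound on the gap *)

Theorem theorem13 (R : realType) (c1 c2 : R) (hc1 : 0 < c1) (hc2 : 0 < c2) :
  exists2 c : R, 0 < c &
  forall (n N : nat) (hN : N = (2 ^ n)%N)
    (H : 'M[R[i]]_N) (hH : H \is hermsymmx)
    (lambda : 'I_N -> R) (psi : 'I_N -> 'cV[R[i]]_N)
    (psi_orthonormal : orthonormal_family psi)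
    (psi_eigen : forall i, H *m psi i = (lambda i)%:C *: psi i)
    (d : measure_display) (T : measurableType d) (P : probability T R)
    (A : T -> 'M[R[i]]_N) (A_measurable : mxmeasurable A)
    (A_hermitian : forall a, A a \is hermsymmx)
    (xi : R) (xi_gt0 : 0 < xi)
    (xi_lower : c1 / Num.sqrt N%:R <= xi)
    (xi_upper : xi <= c2 / Num.sqrt N%:R)
    (A_covariance : forall i j k l : 'I_N,
       cintegral P (fun a => matrix_element (psi i) (A a) (psi j)
                             * (matrix_element (psi l) (A a) (psi k))^*%R)
       = (xi ^+ 2)%:C * (i == l)%:R * (j == k)%:R)
    (beta : R) (beta_gt0 : 0 < beta)
    (f : R -> R[i]) (f_integrable : cintegrable lebesgue_measure f)
    (f_fourier : forall w : R, bohr_freq H w ->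
       fourier f w = (Num.sqrt (metropolis beta w))%:C),
  ((c * low_energy_ratio beta H lambda)%:E
     <= spectral_gap (gibbs beta H) (mean_lindblad P f H A))%E.
Proof.
(* [c1 ^+ 2] bounds [xi ^+ 2 * N] from below, [expR (-1)] is the least rate into a low level, and
   the 2 comes from symmetrizing the Dirichlet form. *)
exists (c1 ^+ 2 * (expR (-1) / 2)).
  by rewrite mulr_gt0 ?exprn_gt0 // divr_gt0 ?expR_gt0.
move=> n N hN H hH lambda psi psiO psiE d T P A mA _ xi xi0 xi_lo _ covA beta b0 f fI fF.
have N0 : (0 < N)%N by rewrite hN expn_gt0.
pose U := frame_mx psi; have UU := frame_mx_unitary psiO.
pose r (i j : 'I_N) : R[i] := (xi ^+ 2 * metropolis beta (lambda i - lambda j))%:C.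
have Lcov rho : mean_lindblad P f H A (conjU U rho) = conjU U (davies_mx r rho).
  by apply: mean_lindblad_conjU => // w; exact: metropolis_ge0.
(* The adjoint property needs a bundled linear map. Linearity is evident for this closed form, which
   agrees with the averaged generator everywhere. *)
pose F rho := conjU U (davies_mx r (U^t* *m rho *m U)).
have Flin : linear F.
  move=> a X Y; rewrite /F mulmxDr mulmxDl -scalemxAr -scalemxAl.
  by rewrite davies_mx_linear conjUD conjUZ.
have -> : mean_lindblad P f H A = F.
  by apply/funext => rho; rewrite -[in LHS](conjUVK UU rho) Lcov.
pose L : {linear 'M[R[i]]_N -> 'M[R[i]]_N} :=
  HB.pack F (GRing.isLinear.Build _ _ _ _ F Flin).
have LE rho : L (conjU U rho) = conjU U (davies_mx r rho).
  by rewrite /= /F conjUK.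
rewrite -[F]/(L : _ -> _); apply/ereal_infP => _ [X Xns <-].
rewrite lee_fin.
pose x := U^t* *m X *m U.
have XE : X = conjU U x by rewrite conjUVK.
have xns : ~~ is_scalar_mx x.
  apply: contra Xns => /is_scalar_mxP[a xa]; apply/is_scalar_mxP; exists a.
  by rewrite XE xa conjU_scalar.
pose low := [set i | lambda i <= lambda_min H + beta^-1]%SET.
have V0 := variance_kms_gt0 hH psiO psiE N0 beta xns.
have low_ge i j : j \in low -> expR (-1) <= metropolis beta (lambda j - lambda i).
  rewrite inE => jlow; apply: metropolis_low => //.
  (* A low level lies at most [beta^-1] above the ground energy, hence at most [beta^-1] above any
     level [lambda i]. *)
  rewrite lerBlDl (le_trans jlow) // lerD2r.
  exact: lambda_min_le hH psiO psiE i.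
have := kms_davies_ge hH psiO psiE N0 x (sqr_ge0 xi) (expR_ge0 _)
  (metropolis_ge0 beta) (metropolis_balance beta lambda) low_ge LE.
rewrite -ler_pdivlMr // -XE.
(* The order on complex numbers compares real parts and equates imaginary parts; the gap uses the
   real parts. *)
rewrite lecE => /andP[_]; apply: le_trans.
have xi2 : c1 ^+ 2 / N%:R <= xi ^+ 2.
  rewrite -[X in _ / X](@sqr_sqrtr _ N%:R) ?ler0n // -expr_div_n.
  by rewrite lerXn2r ?nnegrE ?(ltW xi0) // divr_ge0 ?sqrtr_ge0 // ltW.
rewrite /low_energy_ratio -/low /=.
rewrite (_ : _ * _ * (_ / _) = c1 ^+ 2 / N%:R * (expR (-1) / 2) * #|low|%:R).
  by rewrite !ler_wpM2r ?divr_ge0 ?expR_ge0.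
by rewrite !mulrA; ring.
Qed.
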